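(* Let $k$ be a field and let $V^{\bullet}:\ 0\to V^0\to V^1\to V^2\to\cdots$ be a cochain complex of $k$-vector spaces (not necessarily finite, and with the $V^n$ not necessarily finite dimensional) whose cohomology groups $H^n(V^{\bullet})$ are all finite dimensional over $k$ and vanish for all sufficiently large $n$. Let $V^{\bullet}_{\hbar}$ be a deformation of $V^{\bullet}$. Then the Euler-Poincaré characteristic remains well defined and is invariant under the deformation, i.e. the groups $H^n(V^{\bullet}_{\hbar})$ are finite dimensional over $k((\hbar))$, vanish for all sufficiently large $n$, and $$\sum_n(-1)^n\dim_{k((\hbar))}H^n(V^{\bullet}_{\hbar})=\sum_n(-1)^n\dim_kH^n(V^{\bullet}).$$ Moreover $\dim_{k((\hbar))} H^n(V^{\bullet}_{\hbar})\le\dim_k H^n(V^{\bullet})$ for all $n$.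
   Context: Let $\delta^{(n)}:V^n\to V^{n+1}$ be the coboundary operators of $V^{\bullet}$. A deformation of $V^{\bullet}$ is a sequence of formal operators $\delta^{(n)}_{\hbar}=\delta^{(n)}+\hbar\delta^{(n)}_1+\hbar^2\delta^{(n)}_2+\cdots$, with each $\delta_i^{(n)}:V^n\to V^{n+1}$ a $k$-linear map, such that $\delta^{(n+1)}_{\hbar}\delta^{(n)}_{\hbar}=0$ for all $n$. These operators act on $V^n[[\hbar]]$ (formal power series with coefficients in $V^n$), $k[[\hbar]]$-linearly and in the obvious way. Adjoining $\hbar^{-1}$, they act on the $k((\hbar))$-vector spaces $V^n((\hbar))$ of formal Laurent series (finitely many negative powers of $\hbar$) with coefficients in $V^n$. $V^{\bullet}_{\hbar}$ denotes the resulting complex of $k((\hbar))$-vector spaces $V^n((\hbar))$ with coboundaries $\delta^{(n)}_{\hbar}$. The Euler-Poincaré characteristic of a complex with finite dimensional cohomology vanishing in large degrees is the alternating sum of the dimensions of its cohomology groups. *)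

(* Defs.v *)
From HB Require Import structures.
From mathcomp Require Import all_boot all_order all_algebra.
From mathcomp Require Import boolp classical_sets functions cardinality fsbigop.
From mathcomp Require Import zify.

Set Implicit Arguments.
Unset Strict Implicit.
Unset Printing Implicit Defensive.

Import Order.TTheory GRing.Theory Num.Theory.
Local Open Scope ring_scope.

Lemma fsumE (C : zmodType) (T : choiceType) (r : seq T) (f : T -> C) :
    (forall i, f i != 0 -> i \in r) ->
  \sum_(i \in [set: T]) f i = \sum_(i <- undup r) f i.
Proof.
move=> fr; rewrite (fsbigE (undup r)) ?undup_uniq//; last first.
  move=> i _; rewrite mem_undup => ir.
  by apply/eqP; apply: contraNT ir => /fr.
by apply: eq_bigl => i; rewrite in_setT.
Qed.

Lemma fsumD (C : zmodType) (T : choiceType) (r s : seq T) (f g : T -> C) :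
    (forall i, f i != 0 -> i \in r) -> (forall i, g i != 0 -> i \in s) ->
  \sum_(i \in [set: T]) (f i + g i) =
  \sum_(i \in [set: T]) f i + \sum_(i \in [set: T]) g i.
Proof.
move=> fr gs.
have fP i : f i != 0 -> i \in r ++ s by move/fr; rewrite mem_cat => ->.
have gP i : g i != 0 -> i \in r ++ s by move/gs; rewrite mem_cat orbC => ->.
rewrite (fsumE fP) (fsumE gP) (@fsumE _ _ (r ++ s)) ?big_split// => i.
apply: contraNT => irs; have [/eqP-> /eqP->] : f i == 0 /\ g i == 0.
  by split; apply: contraNT irs; [move/fP | move/gP].
by rewrite addr0.
Qed.

Lemma raddf_fsum (C D : zmodType) (h : C -> D) (T : choiceType) (r : seq T)
    (f : T -> C) : h 0 = 0 -> {morph h : x y / x + y} ->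
    (forall i, f i != 0 -> i \in r) ->
  h (\sum_(i \in [set: T]) f i) = \sum_(i \in [set: T]) h (f i).
Proof.
move=> h0 hD fr; rewrite (fsumE fr) (@fsumE _ _ r); last first.
  by move=> i hf; apply: fr; apply: contraNN hf => /eqP->; rewrite h0.
exact: (big_morph h hD h0).
Qed.

Lemma exchange_fsum (C : zmodType) (T U : choiceType) (r : seq T) (s : seq U)
    (F : T -> U -> C) :
    (forall i j, F i j != 0 -> i \in r /\ j \in s) ->
  \sum_(i \in [set: T]) \sum_(j \in [set: U]) F i j =
  \sum_(j \in [set: U]) \sum_(i \in [set: T]) F i j.
Proof.
move=> Frs.
have F1 i : \sum_(j \in [set: U]) F i j = \sum_(j <- undup s) F i j.
  by apply: fsumE => j /Frs[].
have F2 j : \sum_(i \in [set: T]) F i j = \sum_(i <- undup r) F i j.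
  by apply: fsumE => i /Frs[].
under eq_fsbigr do rewrite F1.
under [RHS]eq_fsbigr do rewrite F2.
rewrite (@fsumE _ _ r) ?(@fsumE _ _ s) 1?exchange_big//.
- move=> j; apply: contraNT => js; rewrite big1// => i _.
  by apply/eqP; apply: contraNT js => /Frs[].
- move=> i; apply: contraNT => ir; rewrite big1// => j _.
  by apply/eqP; apply: contraNT ir => /Frs[].
Qed.

Lemma fsum_ord (C : zmodType) (N : nat) (f : nat -> C) :
    (forall i, f i != 0 -> (i < N)%N) ->
  \sum_(i \in [set: nat]) f i = \sum_(i < N) f i.
Proof.
move=> fN; rewrite (@fsumE _ _ (index_iota 0 N)); last first.
  by move=> i /fN; rewrite mem_index_iota.
by rewrite undup_id ?iota_uniq// big_mkord.
Qed.

Definition int_range (N : nat) : seq int := [seq i%:Z - N%:Z | i <- iota 0 (2 * N).+1].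

Lemma mem_int_range (N : nat) (i : int) : - N%:Z <= i <= N%:Z -> i \in int_range N.
Proof.
move=> iN; apply/mapP; exists (absz (i + N%:Z)); last by lia.
by rewrite mem_iota; lia.
Qed.

Lemma fsum_shift (C : zmodType) (c : int) (f : int -> C) :
  \sum_(i \in [set: int]) f i = \sum_(i \in [set: int]) f (i - c).
Proof.
apply: (reindex_fsbigT (fun i : int => i - c)).
by exists (fun i => i + c) => i; rewrite ?subrK ?addrK.
Qed.

Lemma fsum_rev (C : zmodType) (c : int) (f : int -> C) :
  \sum_(i \in [set: int]) f i = \sum_(i \in [set: int]) f (c - i).
Proof.
apply: (reindex_fsbigT (fun i : int => c - i)).
by exists (fun i => c - i) => i; rewrite subKr.
Qed.

Definition bounded_below (V : zmodType) : {pred int -> V} :=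
  fun f => `[< exists N : int, forall i, i < N -> f i = 0 >].

(* V((hbar)): the series with terms [f i * hbar ^ i], finitely many of which have
   i < 0.  For a commutative ring R, [laurent R] is the ring R((hbar)) with the
   Cauchy product, and [laurent V] is a module over it. *)
Record laurent (V : zmodType) :=
  Laurent { lcoef :> int -> V; _ : lcoef \in @bounded_below V }.

HB.instance Definition _ (V : zmodType) := [isSub for @lcoef V].
HB.instance Definition _ (V : zmodType) := [Choice of laurent V by <:].

Fact bounded_below_zmod (V : zmodType) : zmod_closed (@bounded_below V).
Proof.
split; first by apply/asboolP; exists 0.
move=> f g /asboolP[N fN] /asboolP[M gM]; apply/asboolP.
exists (Num.min N M) => i; rewrite lt_min => /andP[iN iM].
by rewrite !fctE fN// gM// subrr.
Qed.
HB.instance Definition _ (V : zmodType) :=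
  GRing.isZmodClosed.Build (int -> V) (@bounded_below V) (bounded_below_zmod V).
HB.instance Definition _ (V : zmodType) :=
  [SubChoice_isSubZmodule of laurent V by <:].

Lemma laurentP (V : zmodType) (f g : laurent V) : (forall n, f n = g n) -> f = g.
Proof. by move=> fg; apply/val_inj/funext. Qed.

Lemma laurent_bound (V : zmodType) (f : laurent V) :
  exists N : nat, forall i, i < - N%:Z -> f i = 0.
Proof.
case: f => f /= /asboolP[N fN]; exists `|N|%N => i iN; apply: fN; lia.
Qed.

Lemma laurentD (V : zmodType) (f g : laurent V) n : (f + g) n = f n + g n.
Proof. by []. Qed.

Lemma laurent0 (V : zmodType) n : (0 : laurent V) n = 0.
Proof. by []. Qed.

Section Cauchy.
Variables (A B C : zmodType) (op : A -> B -> C).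
Hypothesis op0l : forall b, op 0 b = 0.
Hypothesis op0r : forall a, op a 0 = 0.

(* For [f] and [g] bounded below, only finitely many terms are nonzero. *)
Definition cauchy (f : int -> A) (g : int -> B) : int -> C :=
  fun n => \sum_(i \in [set: int]) op (f i) (g (n - i)).

Lemma cauchy_supp (f : laurent A) (g : laurent B) (n : int) :
  exists r : seq int, forall i, op (f i) (g (n - i)) != 0 -> i \in r.
Proof.
have [N fN] := laurent_bound f; have [M gM] := laurent_bound g.
exists (int_range (N + M + `|n|)%N) => i ne; apply: mem_int_range.
have iN : - N%:Z <= i.
  by rewrite leNgt; apply: contraNN ne => /fN->; rewrite op0l.
have iM : - M%:Z <= n - i.
  by rewrite leNgt; apply: contraNN ne => /gM->; rewrite op0r.
by lia.
Qed.

Fact cauchy_subproof (f : laurent A) (g : laurent B) :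
  cauchy f g \in @bounded_below C.
Proof.
have [N fN] := laurent_bound f; have [M gM] := laurent_bound g.
apply/asboolP; exists (- N%:Z - M%:Z) => n nNM; rewrite /cauchy fsbig1// => i _.
have [/fN->|iN] := ltP i (- N%:Z); first by rewrite op0l.
by rewrite gM ?op0r//; lia.
Qed.

Hypothesis opDl : forall b, {morph op^~ b : x y / x + y}.
Hypothesis opDr : forall a, {morph op a : x y / x + y}.

Lemma cauchyDl (f f' : laurent A) (g : laurent B) n :
  cauchy (f + f') g n = cauchy f g n + cauchy f' g n.
Proof.
have [r P] := cauchy_supp f g n; have [s Q] := cauchy_supp f' g n.
by rewrite -(fsumD P Q); apply: eq_fsbigr => i _; rewrite laurentD opDl.
Qed.

Lemma cauchyDr (f : laurent A) (g g' : laurent B) n :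
  cauchy f (g + g') n = cauchy f g n + cauchy f g' n.
Proof.
have [r P] := cauchy_supp f g n; have [s Q] := cauchy_supp f g' n.
by rewrite -(fsumD P Q); apply: eq_fsbigr => i _; rewrite laurentD opDr.
Qed.
End Cauchy.

Lemma cauchyA (A B C D E F : zmodType) (op1 : A -> B -> D) (op2 : D -> C -> E)
    (op3 : B -> C -> F) (op4 : A -> F -> E)
    (f : laurent A) (g : laurent B) (v : laurent C) (n : int) :
  (forall b, op1 0 b = 0) -> (forall a, op1 a 0 = 0) ->
  (forall b, op2 0 b = 0) -> (forall a, op2 a 0 = 0) ->
  (forall b, op3 0 b = 0) -> (forall a, op3 a 0 = 0) ->
  (forall a, op4 a 0 = 0) ->
  (forall c, {morph op2^~ c : x y / x + y}) ->
  (forall a, {morph op4 a : x y / x + y}) ->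
  (forall a b c, op4 a (op3 b c) = op2 (op1 a b) c) ->
  cauchy op4 f (cauchy op3 g v) n = cauchy op2 (cauchy op1 f g) v n.
Proof.
move=> o1l o1r o2l o2r o3l o3r o4r o2D o4D opA.
have [N fN] := laurent_bound f; have [M gM] := laurent_bound g.
have [L vL] := laurent_bound v.
rewrite /cauchy.
transitivity (\sum_(i \in [set: int]) \sum_(j \in [set: int])
    op2 (op1 (f i) (g j)) (v (n - i - j))).
  apply: eq_fsbigr => i _.
  have [r P] := cauchy_supp o3l o3r g v (n - i).
  by rewrite (raddf_fsum (o4r _) (o4D _) P); apply: eq_fsbigr => j _.
transitivity (\sum_(m \in [set: int]) \sum_(i \in [set: int])
    op2 (op1 (f i) (g (m - i))) (v (n - m))); last first.
  apply: eq_fsbigr => m _.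
  have [r P] := cauchy_supp o1l o1r f g m.
  by rewrite (raddf_fsum (o2l _) (o2D _) P).
set I := int_range (N + M + L + `|n|)%N.
rewrite [RHS](@exchange_fsum _ _ _ I I).
  apply: eq_fsbigr => i _; rewrite [RHS](fsum_shift (- i)).
  apply: eq_fsbigr => j _ /=; have -> : j - - i - i = j by lia.
  by have -> : n - (j - - i) = n - i - j by lia.
move=> m i ne.
have iN : - N%:Z <= i.
  by rewrite leNgt; apply: contraNN ne => /fN->; rewrite o1l o2l.
have jM : - M%:Z <= m - i.
  by rewrite leNgt; apply: contraNN ne => /gM->; rewrite o1r o2l.
have mL : - L%:Z <= n - m.
  by rewrite leNgt; apply: contraNN ne => /vL->; rewrite o2r.
by split; apply: mem_int_range; lia.
Qed.

Section LaurentRing.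
Variable R : comNzRingType.
Implicit Types f g h : laurent R.

Definition laurent_mul f g : laurent R :=
  Laurent (cauchy_subproof (@mul0r R) (@mulr0 R) f g).

Fact laurent_one_subproof :
  (fun i : int => (i == 0)%:R : R) \in @bounded_below R.
Proof. by apply/asboolP; exists 0 => i; case: eqP => // ->; rewrite ltxx. Qed.
Definition laurent_one : laurent R := Laurent laurent_one_subproof.

Fact laurent_mulA : associative laurent_mul.
Proof.
move=> f g h; apply: laurentP => n.
apply: cauchyA.
- exact: mul0r.
- exact: mulr0.
- exact: mul0r.
- exact: mulr0.
- exact: mul0r.
- exact: mulr0.
- exact: mulr0.
- by move=> ? ? ?; rewrite mulrDl.
- by move=> ? ? ?; rewrite mulrDr.
- exact: mulrA.
Qed.

Fact laurent_mulC : commutative laurent_mul.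
Proof.
move=> f g; apply: laurentP => n; rewrite /= /cauchy (fsum_rev n).
by apply: eq_fsbigr => i _; rewrite subKr mulrC.
Qed.

Lemma cauchy1 (A C : zmodType) (op : R -> A -> C) (h : A -> C)
    (v : laurent A) n :
  (forall b, op 0 b = 0) -> (forall b, op 1 b = h b) ->
  cauchy op laurent_one v n = h (v n).
Proof.
move=> o0 o1; rewrite /cauchy (@fsumE _ _ [:: 0]).
  by rewrite /= big_seq1 eqxx o1 subr0.
by move=> i; rewrite /= inE; apply: contraNT => /negPf->; rewrite o0.
Qed.

Fact laurent_mul1 : left_id laurent_one laurent_mul.
Proof.
move=> f; apply: laurentP => n.
exact: (cauchy1 (h := id) _ _ (@mul0r R) (@mul1r R)).
Qed.

Fact laurent_mulD : left_distributive laurent_mul +%R.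
Proof.
move=> f g h; apply: laurentP => n.
by apply: cauchyDl => [?|?|? ? ?]; rewrite ?mul0r ?mulr0 ?mulrDl.
Qed.

Fact laurent_one_neq0 : laurent_one != 0.
Proof.
apply/eqP => /(congr1 (fun f : laurent R => f 0)) /= /eqP.
by rewrite oner_eq0.
Qed.

HB.instance Definition _ := GRing.Zmodule_isComNzRing.Build (laurent R)
  laurent_mulA laurent_mulC laurent_mul1 laurent_mulD laurent_one_neq0.
End LaurentRing.

Section LaurentModule.
Variables (R : comNzRingType) (V : lmodType R).
Implicit Types (f g : laurent R) (v w : laurent V).

Definition laurent_scale f v : laurent V :=
  Laurent (cauchy_subproof (@scale0r R V) (@scaler0 R V) f v).

Fact laurent_scaleA f g v :
  laurent_scale f (laurent_scale g v) = laurent_scale (f * g) v.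
Proof.
apply: laurentP => n; apply: cauchyA.
- exact: mul0r.
- exact: mulr0.
- exact: scale0r.
- exact: scaler0.
- exact: scale0r.
- exact: scaler0.
- exact: scaler0.
- by move=> ? ? ?; rewrite scalerDl.
- by move=> ? ? ?; rewrite scalerDr.
- exact: scalerA.
Qed.

Fact laurent_scale1 : left_id 1 laurent_scale.
Proof.
move=> v; apply: laurentP => n.
exact: (cauchy1 (h := id) _ _ (@scale0r R V) (@scale1r R V)).
Qed.

Fact laurent_scaleDr : right_distributive laurent_scale +%R.
Proof.
move=> f v w; apply: laurentP => n.
by apply: cauchyDr => [?|?|? ? ?]; rewrite ?scale0r ?scaler0 ?scalerDr.
Qed.

Fact laurent_scaleDl v : {morph laurent_scale^~ v : f g / f + g}.
Proof.
move=> f g; apply: laurentP => n.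
by apply: cauchyDl => [?|?|? ? ?]; rewrite ?scale0r ?scaler0 ?scalerDl.
Qed.

HB.instance Definition _ := GRing.Zmodule_isLmodule.Build (laurent R) (laurent V)
  laurent_scaleA laurent_scale1 laurent_scaleDr laurent_scaleDl.
End LaurentModule.

Section LaurentField.
Variable k : fieldType.

Lemma series_inverse (a : nat -> k) : a 0%N != 0 ->
  exists b : nat -> k, forall n, \sum_(i < n.+1) a i * b (n - i)%N = (n == 0)%:R.
Proof.
move=> a0.
pose next (s : seq k) : k := (a 0%N)^-1 * ((size s == 0)%:R -
  \sum_(i < size s) a i.+1 * s`_(size s - i.+1)).
pose bs := fix bs n := if n is m.+1 then rcons (bs m) (next (bs m)) else [::].
have size_bs n : size (bs n) = n by elim: n => //= n IH; rewrite size_rcons IH.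
have nth_bs m n : (m < n)%N -> (bs n)`_m = next (bs m).
  elim: n => // n IH; rewrite ltnS leq_eqVlt /= nth_rcons size_bs.
  by case: ltngtP => [/IH//|//|->].
exists (fun n => next (bs n)) => n.
rewrite big_ord_recl subn0 {1}/next size_bs mulVKf//.
rewrite -[RHS](subrK (\sum_(i < n) a i.+1 * (bs n)`_(n - i.+1))); congr (_ + _).
by apply: eq_bigr => -[i /= iltn] _; rewrite nth_bs//; lia.
Qed.

Lemma laurent_inverse (f : laurent k) : f != 0 -> exists g, g * f = 1.
Proof.
move=> fn0; have [N fN] := laurent_bound f.
have exl : exists l : nat, f (l%:Z - N%:Z) != 0.
  apply: contrapT => /forallNP f0; case/eqP: fn0; apply: laurentP => n.
  have [/fN//|nN] := ltP n (- N%:Z).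
  have := f0 (absz (n + N%:Z)); have -> : (absz (n + N%:Z))%:Z - N%:Z = n by lia.
  by move/negP; rewrite negbK => /eqP.
case: (ex_minnP exl) => l fl lmin; set m := l%:Z - N%:Z in fl.
have fm i : i < m -> f i = 0.
  have [/fN//|iN im] := ltP i (- N%:Z).
  apply/eqP; apply: contraTT isT => fi.
  have := lmin (absz (i + N%:Z)); have -> : (absz (i + N%:Z))%:Z - N%:Z = i by lia.
  by move=> /(_ fi); lia.
have [|b bP] := @series_inverse (fun i => f (m + i%:Z)); first by rewrite addr0.
pose gc (j : int) : k := if j + m is Posz p then b p else 0.
have gcP : gc \in @bounded_below k.
  apply/asboolP; exists (- m) => i im; rewrite /gc.
  case E : (i + m) => [p|//]; lia.
exists (Laurent gcP); rewrite mulrC; apply: laurentP => n /=.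
rewrite /cauchy /=.
case: n => [p|p]; last first.
  rewrite fsbig1// => i _; have [/fm->|im] := ltP i m; first by rewrite mul0r.
  rewrite /gc; case E : (_ + m) => [q|q]; last by rewrite mulr0.
  by lia.
rewrite (fsum_shift (- m)) (@fsumE _ _ [seq i%:Z | i <- iota 0 p.+1]); last first.
  move=> i ne; apply/mapP; exists (absz i).
    rewrite mem_iota /=.
    have i0 : 0 <= i.
      by rewrite leNgt; apply: contraNN ne => i0; rewrite fm ?mul0r//; lia.
    suff : i <= p%:Z by lia.
    rewrite leNgt; apply: contraNN ne => ip; rewrite /gc.
    case E : (_ + m) => [q|q]; last by rewrite mulr0.
    by lia.
  have i0 : 0 <= i.
    by rewrite leNgt; apply: contraNN ne => i0; rewrite fm ?mul0r//; lia.
  by lia.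
rewrite undup_id; last by rewrite map_inj_uniq ?iota_uniq// => ? ? [].
rewrite big_map -[iota 0 p.+1]/(index_iota 0 p.+1) big_mkord.
rewrite -[RHS]/((p == 0)%:R) -bP; apply: eq_bigr => -[i /= ip] _.
rewrite opprK addrC; congr (_ * _); rewrite /gc.
by have -> : Posz p - (m + i%:Z) + m = (p - i)%N%:Z by lia.
Qed.

Definition laurent_inv (f : laurent k) : laurent k := xget 0 [set g | g * f = 1].

Fact laurent_mulV (f : laurent k) : f != 0 -> laurent_inv f * f = 1.
Proof.
by move=> /laurent_inverse[g gf]; apply: (xgetPex 0 (P := [set g | g * f = 1])); exists g.
Qed.

Fact laurent_inv0 : laurent_inv 0 = 0.
Proof.
apply: xgetPN => g /= /esym /eqP.
by rewrite mulr0 (negPf (oner_neq0 _)).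
Qed.

HB.instance Definition _ :=
  GRing.ComNzRing_isField.Build (laurent k) laurent_mulV laurent_inv0.
End LaurentField.

Definition has_dim (k : fieldType) (M : lmodType k) (m : nat) : Prop :=
  inhabited (Vector.axiom m M).

Definition finite_dim (k : fieldType) (M : lmodType k) : Prop :=
  exists m, has_dim M m.

(* The junk value 0 is taken when [M] is infinite dimensional. *)
Definition vdim (k : fieldType) (M : lmodType k) : nat := xget 0%N [set m | has_dim M m].

Lemma has_dim_uniq (k : fieldType) (M : lmodType k) (m m' : nat) :
  has_dim M m -> has_dim M m' -> m = m'.
Proof.
wlog : m m' / (m < m')%N => [H hm hm'|lt].
  by case: (ltngtP m m') => [/H->//|/H H'|//]; rewrite H'.
case=> -[f fL [f' fK f'K]] [[g gL [g' gK g'K]]]; exfalso.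
pose fl := GRing.isLinear.Build k M 'rV_m _ f fL.
pose gl := GRing.isLinear.Build k M 'rV_m' _ g gL.
pose F : {linear M -> 'rV_m} := HB.pack f fl.
pose G : {linear M -> 'rV_m'} := HB.pack g gl.
have g'L : linear g'.
  by move=> a x y; apply: (can_inj gK); rewrite g'K gL !g'K.
pose g'l := GRing.isLinear.Build k 'rV_m' M _ g' g'L.
pose G' : {linear 'rV_m' -> M} := HB.pack g' g'l.
pose A := lin1_mx (F \o G').
have [u uA un0] : exists2 u : 'rV_m', u *m A = 0 & u != 0.
  have: kermx A != 0.
    rewrite -mxrank_eq0 mxrank_ker subn_eq0 -ltnNge.
    exact: leq_ltn_trans (rank_leq_col _) lt.
  move/rowV0Pn => [u /sub_kermxP uA un0]; by exists u.
case/eqP: un0; rewrite mul_rV_lin1 /= in uA.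
have g'0 : g' 0 = 0 := linear0 G'.
have f0 : f 0 = 0 := linear0 F.
have : g' u = g' 0 by apply: (can_inj fK); rewrite g'0 f0.
exact: (can_inj g'K).
Qed.

Lemma vdimP (k : fieldType) (M : lmodType k) (m : nat) :
  has_dim M m -> vdim M = m.
Proof.
move=> hm; apply: (has_dim_uniq _ hm).
by apply: (xgetPex 0%N (P := [set m | has_dim M m])); exists m.
Qed.

Record cochain_complex (k : fieldType) := CochainComplex {
  cochain :> nat -> lmodType k;
  cobound : forall n, {linear cochain n -> cochain n.+1};
  coboundK : forall n x, cobound n.+1 (cobound n x) = 0
}.
Arguments cobound {k} c n.

Section Cohomology.
Variables (k : fieldType) (C : cochain_complex k) (n : nat).

Definition is_cocycle : {pred C n} := [pred x | cobound C n x == 0].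

Fact is_cocycle_submod : submod_closed is_cocycle.
Proof.
split=> [|a x y]; rewrite !inE ?linear0// => /eqP x0 /eqP y0.
by rewrite linearP x0 y0 scaler0 addr0.
Qed.
HB.instance Definition _ :=
  GRing.isSubmodClosed.Build k (C n) is_cocycle is_cocycle_submod.

Record cocycle := Cocycle { cocycle_val :> C n; _ : cocycle_val \in is_cocycle }.

HB.instance Definition _ := [isSub for cocycle_val].
HB.instance Definition _ := [Choice of cocycle by <:].
HB.instance Definition _ := [SubChoice_isSubLmodule of cocycle by <:].

(* In degree 0 the incoming map is 0 -> V^0. *)
Definition in_image : C n -> Prop :=
  match n return C n -> Prop with
  | 0 => fun x => x = 0
  | m.+1 => fun x => exists y, cobound C m y = x
  end.

Definition is_coboundary : {pred cocycle} := fun z => `[< in_image z >].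

Fact is_coboundary_submod : submod_closed is_coboundary.
Proof.
have im0 : in_image 0.
  by rewrite /in_image; case: n => // m; exists 0; rewrite linear0.
have imP a (x y : C n) : in_image x -> in_image y -> in_image (a *: x + y).
  rewrite /in_image; case: n x y => [|m] x y; first by move=> -> ->; rewrite scaler0 addr0.
  by move=> [u <-] [v <-]; exists (a *: u + v); rewrite linearP.
split; first exact/asboolP.
by move=> a x y /asboolP xi /asboolP yi; apply/asboolP; apply: imP.
Qed.
HB.instance Definition _ :=
  GRing.isSubmodClosed.Build k cocycle is_coboundary is_coboundary_submod.

Definition cohomology : Type := {ideal_quot is_coboundary}.

End Cohomology.

Section CohomologyModule.
Variables (k : fieldType) (C : cochain_complex k) (n : nat).
Local Notation H := (cohomology C n).

HB.instance Definition _ := GRing.Zmodule.on H.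

Definition cohomology_class (z : cocycle C n) : H :=
  (\pi_({ideal_quot @is_coboundary k C n}) z)%qT.

Lemma cohomology_classD : {morph cohomology_class : x y / x + y}.
Proof. exact: (raddfD (\pi_({ideal_quot @is_coboundary k C n}))%qT). Qed.

Lemma cohomology_class_eq (x y : cocycle C n) :
  cohomology_class x = cohomology_class y <-> in_image (cocycle_val (x - y)).
Proof.
split=> [xy|xy].
  have : x - y \in @is_coboundary k C n by rewrite Quotient.idealrBE; apply/eqP.
  by move/asboolP.
by apply/eqP; rewrite -Quotient.idealrBE; apply/asboolP.
Qed.

Lemma cohomology_classP (u : H) : exists z, u = cohomology_class z.
Proof. by exists (repr u); rewrite /cohomology_class reprK. Qed.

Definition cohomology_scale (a : k) (u : H) : H := cohomology_class (a *: repr u).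

Lemma cohomology_scaleE a (z : cocycle C n) :
  cohomology_scale a (cohomology_class z) = cohomology_class (a *: z).
Proof.
apply/cohomology_class_eq; rewrite -scalerBr.
set w := repr _ - z.
have wI : w \in @is_coboundary k C n.
  by rewrite Quotient.idealrBE /cohomology_class reprK.
by apply/asboolP; exact: (rpredZ a wI).
Qed.

Fact cohomology_scaleA a b u :
  cohomology_scale a (cohomology_scale b u) = cohomology_scale (a * b) u.
Proof.
by have [z ->] := cohomology_classP u; rewrite !cohomology_scaleE scalerA.
Qed.

Fact cohomology_scale1 : left_id 1 cohomology_scale.
Proof.
by move=> u; have [z ->] := cohomology_classP u; rewrite cohomology_scaleE scale1r.
Qed.

Fact cohomology_scaleDr : right_distributive cohomology_scale +%R.
Proof.
move=> a u v; have [x ->] := cohomology_classP u.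
have [y ->] := cohomology_classP v.
by rewrite -cohomology_classD !cohomology_scaleE scalerDr cohomology_classD.
Qed.

Fact cohomology_scaleDl u : {morph cohomology_scale^~ u : a b / a + b}.
Proof.
move=> a b; have [x ->] := cohomology_classP u.
by rewrite !cohomology_scaleE scalerDl cohomology_classD.
Qed.

HB.instance Definition _ := GRing.Zmodule_isLmodule.Build k H
  cohomology_scaleA cohomology_scale1 cohomology_scaleDr cohomology_scaleDl.

End CohomologyModule.

(* The sum over all degrees has finite support when the cohomology vanishes in
   large degrees. *)
Definition euler_char (k : fieldType) (C : cochain_complex k) : int :=
  \sum_(n \in [set: nat]) (-1) ^+ n * (vdim (cohomology C n))%:Z.

Section FormalOperators.
Variables (k : fieldType) (V W : lmodType k) (D : nat -> {linear V -> W}).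

(* The action of D_0 + hbar D_1 + hbar^2 D_2 + ... on V[[hbar]]; a power series is
   given by its coefficients [nat -> V]. *)
Definition series_op (v : nat -> V) : nat -> W :=
  fun m => \sum_(i < m.+1) D i (v (m - i)%N).

(* For [v] bounded below, only finitely many terms are nonzero. *)
Definition laurent_op_coef (v : int -> V) : int -> W :=
  fun n => \sum_(i \in [set: nat]) D i (v (n - i%:Z)).

Lemma laurent_op_supp (v : laurent V) (L : nat) n (i : nat) :
    (forall i, i < - L%:Z -> v i = 0) ->
  D i (v (n - i%:Z)) != 0 -> i%:Z <= n + L%:Z.
Proof.
move=> vL ne.
suff : - L%:Z <= n - i%:Z by lia.
by rewrite leNgt; apply: contraNN ne => /vL->; rewrite linear0.
Qed.

Fact laurent_op_subproof (v : laurent V) :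
  laurent_op_coef v \in @bounded_below W.
Proof.
have [L vL] := laurent_bound v; apply/asboolP; exists (- L%:Z) => n nL.
rewrite /laurent_op_coef fsbig1// => i _; rewrite vL ?linear0//; lia.
Qed.

Definition laurent_op (v : laurent V) : laurent W := Laurent (laurent_op_subproof v).

Lemma laurent_op_ord (v : laurent V) (L N : nat) n :
    (forall i, i < - L%:Z -> v i = 0) -> n + L%:Z < N%:Z ->
  laurent_op v n = \sum_(i < N) D i (v (n - i%:Z)).
Proof.
move=> vL nN; apply: fsum_ord => i /(laurent_op_supp vL); lia.
Qed.

Fact laurent_op_linear : linear laurent_op.
Proof.
move=> a v w; apply: laurentP => n.
have [L vL] := laurent_bound v; have [M wM] := laurent_bound w.
have [N aN] := laurent_bound a.
rewrite laurentD.
transitivity (\sum_(i \in [set: nat]) (\sum_(j \in [set: int])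
   a j *: D i (v (n - j - i%:Z)) + D i (w (n - i%:Z)))).
  apply: eq_fsbigr => i _; rewrite laurentD linearD; congr (_ + _).
  have [s Q] := cauchy_supp (@scale0r k V) (@scaler0 k V) a v (n - i%:Z).
  rewrite /= /cauchy (raddf_fsum (linear0 (D i)) (linearD (D i)) Q).
  by apply: eq_fsbigr => j _; rewrite linearZ /= [n - _ - _]addrAC.
have aP i j : a j *: D i (v (n - j - i%:Z)) != 0 ->
    - N%:Z <= j /\ i%:Z <= n - j + L%:Z.
  move=> ne; split.
    by rewrite leNgt; apply: contraNN ne => /aN->; rewrite scale0r.
  apply: (laurent_op_supp vL); apply: contraNN ne => /eqP->; by rewrite scaler0.
pose I := index_iota 0 (N + L + M + `|n|)%N.+1.
rewrite (@fsumD _ _ I I).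
- congr (_ + _).
  rewrite (@exchange_fsum _ _ _ I (int_range (N + L + `|n|)%N)).
    apply: eq_fsbigr => j _.
    rewrite /= /laurent_op_coef (@raddf_fsum _ _ _ _ (index_iota 0 (`|n| + `|j| + L)%N.+1)) ?scaler0//.
      by move=> x y; rewrite scalerDr.
    by move=> i /(laurent_op_supp vL) ?; rewrite mem_index_iota; lia.
  move=> i j /aP[jN iL]; split; first by rewrite mem_index_iota; lia.
  by apply: mem_int_range; lia.
- move=> i; apply: contraNT => iI; rewrite fsbig1// => j _.
  by apply/eqP; apply: contraNT iI => /aP[? ?]; rewrite mem_index_iota; lia.
- by move=> i /(laurent_op_supp wM) ?; rewrite mem_index_iota; lia.
Qed.
HB.instance Definition _ :=
  GRing.isLinear.Build (laurent k) (laurent V) (laurent W) _ laurent_op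
    laurent_op_linear.

End FormalOperators.

Record deformation (k : fieldType) (C : cochain_complex k) := Deformation {
  deform : forall n, nat -> {linear C n -> C n.+1};
  deform0 : forall n x, deform n 0%N x = cobound C n x;
  deformK : forall n (v : nat -> C n) m,
    series_op (deform n.+1) (series_op (deform n) v) m = 0
}.

Lemma triangular_sum (C : zmodType) (N : nat) (G : nat -> nat -> C) :
    (forall i j, (N <= i + j)%N -> G i j = 0) ->
  \sum_(i < N) \sum_(j < N) G i j = \sum_(m < N) \sum_(i < m.+1) G i (m - i)%N.
Proof.
move=> G0.
transitivity (\sum_(i < N) \sum_(m < N | (i <= m)%N) G i (m - i)%N).
  apply: eq_bigr => i _.
  rewrite -(big_mkord xpredT (G i)) -(big_mkord (leq i) (fun m => G i (m - i)%N)).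
  rewrite (big_cat_nat (n := (N - i)%N)) ?leq_subr//= [X in _ + X]big1_seq ?addr0; last first.
    by move=> j; rewrite mem_index_iota => jN; apply: G0; lia.
  rewrite [RHS](big_cat_nat (n := i)) ?(ltnW (ltn_ord i))//= [X in X + _]big1_seq ?add0r; last first.
    by move=> j; rewrite mem_index_iota; lia.
  have := big_addn 0 N i (leq i) (fun m => G i (m - i)%N).
  rewrite add0n => ->.
  by apply: eq_big => j; rewrite ?leq_addl// addnK.
rewrite (exchange_big_dep xpredT)//=; apply: eq_bigr => m _.
by rewrite (big_ord_widen N (fun i => G i (m - i)%N) (ltn_ord m)).
Qed.

Section DeformedComplex.
Variables (k : fieldType) (C : cochain_complex k) (D : deformation C).

Lemma deformE n m x :
  \sum_(i < m.+1) deform D n.+1 i (deform D n (m - i)%N x) = 0.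
Proof.
rewrite -[RHS](deformK D (n := n) (fun j => if j == 0%N then x else 0) m).
apply: eq_bigr => i _; rewrite /series_op big_ord_recr /= subnn eqxx.
rewrite big1 ?add0r// => j _.
by rewrite subn_eq0 leqNgt ltn_ord linear0.
Qed.

Fact laurent_opK n (v : laurent (C n)) :
  laurent_op (deform D n.+1) (laurent_op (deform D n) v) = 0.
Proof.
apply: laurentP => p.
have [L vL] := laurent_bound v.
have wL i : i < - L%:Z -> laurent_op (deform D n) v i = 0.
  move=> iL; rewrite (laurent_op_ord (L := L) (N := 0) _ vL) ?big_ord0//; lia.
pose N := (`|p| + L).+1%N.
rewrite (laurent_op_ord (L := L) (N := N) _ wL); last by lia.
transitivity (\sum_(i < N) \sum_(j < N)
    deform D n.+1 i (deform D n j (v (p - (i + j)%N%:Z)))).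
  apply: eq_bigr => i _; rewrite (laurent_op_ord (L := L) (N := N) _ vL); last by lia.
  rewrite linear_sum; apply: eq_bigr => j _.
  by rewrite PoszD opprD addrA.
rewrite (triangular_sum (G := fun i j =>
    deform D n.+1 i (deform D n j (v (p - (i + j)%N%:Z))))).
  rewrite big1// => m _; rewrite -[RHS](deformE m (v (p - m%:Z))).
  by apply: eq_bigr => i _; rewrite subnKC// -ltnS.
by move=> i j ij; rewrite vL ?linear0//; lia.
Qed.

Definition deformed_complex : cochain_complex (laurent k) :=
  @CochainComplex (laurent k) (fun n => laurent (C n))
    (fun n => laurent_op (deform D n)) laurent_opK.

End DeformedComplex.

(* Main.v *)
(* Homological perturbation.  Choose k-linear maps s : V^(n+1) -> V^n with s s = 0,
   s delta s = s and delta s delta = delta; then M = {x | s x = 0, s delta x = 0}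
   consists of cocycles and represents H(V).  Let d be the deformed coboundary.
   The operator T = 1 + s (d - delta) on V((hbar)) is invertible because
   d - delta raises the order in hbar, and s T = s, s delta T = s d.  Hence T maps
   K = {x | s x = 0, s d x = 0} isomorphically onto M((hbar)), so that
   dim K^n = dim H^n(V).  Moreover K is stable under d, and it has the cohomology
   of V_hbar: for every y, the element q = T^-1 (s y) satisfies s (y - d q) = 0.
   Thus H(V_hbar) is the cohomology of a complex of finite dimensional spaces of
   dimensions dim H^n(V), and the claims follow from rank-nullity. *)
Require Import Defs.
From HB Require Import structures.
From mathcomp Require Import all_boot all_order all_algebra.
From mathcomp Require Import boolp classical_sets fsbigop.
From mathcomp Require Import zify.
Import Order.TTheory GRing.Theory Num.Theory.
Local Open Scope ring_scope.

Set Implicit Arguments.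
Unset Strict Implicit.
Unset Printing Implicit Defensive.

(** * Linear algebra: generalized inverses by Zorn's lemma *)

Lemma linear_fun (R : pzRingType) (U V : lmodType R) (f : U -> V) :
  linear f -> exists g : {linear U -> V}, g =1 f.
Proof.
move=> fL; pose fl := GRing.isLinear.Build R U V _ f fL.
by pose g : {linear U -> V} := HB.pack f fl; exists g.
Qed.

Lemma linear_inverse (R : pzRingType) (U V : lmodType R) (f : {linear U -> V}) :
  injective f -> (forall y, exists x, f x = y) ->
  exists2 g : {linear V -> U}, cancel f g & cancel g f.
Proof.
move=> fI /choice[g gK]; have fK : cancel f g by move=> x; apply: fI; rewrite gK.
have [h hE] := linear_fun (can2_linear fK gK).
by exists h => x; rewrite hE.
Qed.

(** Zorn's lemma on graphs of partial linear maps that invert [f] wherever the argument lies in its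
    image; a maximal graph is defined on all of [W]. *)
Lemma generalized_inverse (F : fieldType) (V W : lmodType F) (f : {linear V -> W}) :
  exists g : {linear W -> V}, forall x, f (g (f x)) = f x.
Proof.
pose good (A : set (W * V)) :=
  (forall a p q, A p -> A q -> A (a *: p + q)) /\
  (forall w v, A (w, v) -> (exists x, f x = w) -> f v = w) /\
  (forall v, A (0, v) -> v = 0).
have [] := @Zorn_bigcup _ good.
  move=> G Ggood tot; split; [|split].
  - move=> a p q [A GA Ap] [B GB Bq].
    have [AB|BA] := tot A B GA GB.
      by exists B => //; have [H _] := Ggood B GB; apply: H => //; apply: AB.
    by exists A => //; have [H _] := Ggood A GA; apply: H => //; apply: BA.
  - by move=> w v [A GA Awv]; have [_ [H _]] := Ggood A GA; apply: H.
  - by move=> v [A GA Av]; have [_ [_ H]] := Ggood A GA; apply: H.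
move=> A [[Alin [Af A0v]] Amax].
(* The union of an empty chain is empty, so [good] has to admit the empty set; that a maximal graph
   contains (0, 0) takes a separate argument. *)
have A0 : A (0, 0).
  apply: contrapT => nA0; apply: (Amax (A `|` [set (0, 0)])%classic).
    split; last by move=> /(_ (0, 0)) /=; tauto.
    by move=> x Ax; left.
  have nA p : A p -> False.
    by move=> Ap; apply: nA0; have := Alin (-1) _ _ Ap Ap; rewrite scaleN1r addNr.
  split; [|split].
  - by move=> a p q [/nA//|->] [/nA//|->]; right; rewrite /= scaler0 addr0.
  - by move=> w v [/nA//|[-> ->]] _; rewrite linear0.
  - by move=> v [/nA//|[->]].
have AZ a p : A p -> A (a *: p) by move=> Ap; rewrite -[_ *: _]addr0; apply: Alin.
have AB p q : A p -> A q -> A (p - q).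
  by move=> Ap Aq; rewrite addrC -scaleN1r; apply: Alin.
have Atot w : exists v, A (w, v).
  apply: contrapT => nw.
  (* Extend by [w |-> v0], where [v0] is forced as soon as the coset of [w]
     modulo the domain meets the image of [f]. *)
  have [v0 v0P] : exists v0, forall a b x, A (a, b) -> f x = w + a ->
      f (v0 + b) = w + a.
    have [[a [b [x [Aab fx]]]]|no] :=
        pselect (exists a b x, A (a, b) /\ f x = w + a); last first.
      by exists 0 => a b x Aab fx; case: no; exists a, b, x.
    (* Any other such pair differs from [(a, b)] by one lying over the image of [f], where [A]
       already inverts [f]. *)
    exists (x - b) => a' b' x' Aab' fx'.
    have ff : f (b' - b) = a' - a.
      apply: Af; first exact: (AB (a', b') (a, b)).
      by exists (x' - x); rewrite linearB fx fx' opprD addrACA subrr add0r.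
    rewrite -addrA [- b + b']addrC linearD ff fx.
    by rewrite addrACA subrr addr0.
  pose B : set (W * V) := fun p => exists c a b,
    A (a, b) /\ p = (c *: w + a, c *: v0 + b).
  (* A nonzero [c] would put [w] in the domain of [A]; hence the extended graph [B] stays
     single-valued. *)
  have cw c a b : A (a, b) -> c *: w + a = 0 -> c = 0.
    move=> Aab cwa; apply/eqP; apply: contrapT => /negP c0; apply: nw.
    exists (- c^-1 *: b).
    have -> : w = - c^-1 *: a.
      apply: (scalerI c0).
      by rewrite scalerA mulrN divff// scaleN1r; apply/eqP; rewrite -addr_eq0 cwa.
    exact: (AZ _ (a, b)).
  apply: (Amax B).
    split=> [[a b] Aab|BA]; first by exists 0, a, b; rewrite !scale0r !add0r.
    by apply: nw; exists v0; apply: BA; exists 1, 0, 0; rewrite !scale1r !addr0.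
  split; [|split].
  - move=> s _ _ [c [a [b [Aab ->]]]] [c' [a' [b' [Aab' ->]]]].
    exists (s * c + c'), (s *: a + a'), (s *: b + b'); split.
      exact: (Alin s (a, b) (a', b')).
    rewrite -[LHS]/(s *: (c *: w + a) + (c' *: w + a'),
                    s *: (c *: v0 + b) + (c' *: v0 + b')).
    by congr (_, _); rewrite scalerDr scalerDl scalerA addrACA.
  - move=> _ _ [c [a [b [Aab [-> ->]]]]] [x fx].
    have [c0|c0] := eqVneq c 0.
      move: fx; rewrite c0 !scale0r !add0r => fx.
      by apply: Af => //; exists x.
    have e : f (v0 + c^-1 *: b) = w + c^-1 *: a.
      apply: (v0P _ _ (c^-1 *: x) (AZ c^-1 (a, b) Aab)).
      by rewrite linearZ /= fx scalerDr scalerA mulVf// scale1r.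
    rewrite -[b]scale1r -[a]scale1r -(divff c0) -!scalerA -!scalerDr.
    by rewrite linearZ /= e.
  - move=> _ [c [a [b [Aab [/esym cwa ->]]]]].
    have c0 := cw _ _ _ Aab cwa; move: cwa Aab; rewrite c0 !scale0r !add0r => ->.
    exact: A0v.
have [g gP] := choice Atot.
have gU w v : A (w, v) -> v = g w.
  move=> Awv; apply/eqP; rewrite -subr_eq0; apply/eqP/A0v.
  by have := AB _ _ Awv (gP w); rewrite -[X in A X]/(w - w, v - g w) subrr.
have [h hE] := @linear_fun _ W V g (fun a x y => esym (gU _ _ (Alin a _ _ (gP x) (gP y)))).
by exists h => x; rewrite hE; apply: Af; [exact: gP|exists x].
Qed.

(** * Dimension through linear bijections from row vectors *)

Section HasDim.
Variables (F : fieldType) (M : lmodType F).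

Lemma has_dimI m (f : {linear 'rV[F]_m -> M}) :
  injective f -> (forall y, exists x, f x = y) -> has_dim M m.
Proof.
move=> fI fS; have [g fK gK] := linear_inverse fI fS.
by constructor; exists g; [exact: linearP|exists f].
Qed.

Lemma has_dimE m : has_dim M m ->
  exists2 f : {linear 'rV[F]_m -> M}, injective f & forall y, exists x, f x = y.
Proof.
case=> -[g gL [f gK fK]]; have [h hE] := linear_fun gL.
have hK : cancel h f by move=> x; rewrite hE.
have Kh : cancel f h by move=> x; rewrite hE.
have [e eE] := linear_fun (can2_linear hK Kh).
exists e => [x y|y]; first by rewrite !eE; apply: (can_inj fK).
by exists (g y); rewrite eE.
Qed.

Lemma has_dim0 m : has_dim M m -> ((forall u : M, u = 0) <-> m = 0%N).
Proof.
move=> /has_dimE[f fI fS]; split=> [M0|m0 u].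
  case: m f fI fS => // m f fI fS.
  have e : f (const_mx 1) = f 0 by rewrite (M0 (f _)) linear0.
  have /rowP/(_ ord0) := fI _ _ e.
  by rewrite !mxE => /eqP; rewrite oner_eq0.
have [x <-] := fS u; suff -> : x = 0 by rewrite linear0.
by apply/rowP => -[i im]; exfalso; rewrite m0 in im.
Qed.
End HasDim.

(** * Inverting the identity plus an operator that raises the order in hbar *)

Section CausalPerturbation.
Variables (V : zmodType) (G : laurent V -> laurent V).
Hypothesis GB : {morph G : x y / x - y}.
Hypothesis G_causal : forall (x : laurent V) n, (forall i : int, i < n -> x i = 0) -> G x n = 0.

(** The difference z of two preimages satisfies z = - G z, so its coefficients vanish one after
    another from the lowest upwards. *)
Lemma add_causal_inj : injective (fun x => x + G x).
Proof.
move=> x y /= xy; apply/eqP; rewrite -subr_eq0; apply/eqP; set z := x - y.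
have zG n : z n = - G z n.
  apply/eqP; rewrite -addr_eq0 -laurentD /z GB addrACA -opprD xy subrr.
  by rewrite laurent0.
have [L zL] := laurent_bound z.
have z0 (m : nat) (i : int) : i < m%:Z - L%:Z -> z i = 0.
  elim: m i => [|m IH] i im; first by apply: zL; lia.
  by rewrite zG G_causal ?oppr0// => j ji; apply: IH; lia.
by apply: laurentP => n; apply: (z0 (`|n| + L).+1); lia.
Qed.

(* The limit of the iteration [x |-> y - G x], whose coefficients stabilise. *)
Lemma add_causal_surj y : exists x, x + G x = y.
Proof.
have [L yL] := laurent_bound y.
have G0 n : G 0 n = 0 by apply: G_causal.
pose x_ k := iter k (fun x => y - G x) 0.
have xS k : x_ k.+1 = y - G (x_ k) by [].
have coefB (u v : laurent V) n : (u - v) n = u n - v n by [].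
have low k (i : int) : i < - L%:Z -> x_ k i = 0.
  elim: k i => // k IH i iL; rewrite xS coefB yL// G_causal ?subr0// => j ji.
  by apply: IH; lia.
(* Each iteration settles one more coefficient, since [G] sees only strictly lower ones. *)
have step k (i : int) : i < k%:Z - L%:Z -> x_ k.+1 i = x_ k i.
  elim: k i => [|k IH] i ik; first by rewrite !low//; lia.
  apply/eqP; rewrite -subr_eq0 -coefB [x_ k.+2]xS [X in _ - X]xS.
  rewrite opprB addrC addrA subrK -GB G_causal// => j ji.
  by rewrite coefB -IH ?subrr//; lia.
have stab k m (i : int) : i < k%:Z - L%:Z -> x_ (k + m)%N i = x_ k i.
  by move=> ik; elim: m => [|m IH]; rewrite ?addn0// addnS step//; lia.
(* For [i >= - L], coefficient [i] is stable from this iterate on; below [- L] all iterates vanish,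
   so the value of [absz] there is harmless. *)
have XP : (fun i => x_ (absz (i + L%:Z)).+1 i) \in @bounded_below V.
  by apply/asboolP; exists (- L%:Z) => i iL; apply: low.
pose X := Laurent XP.
have XE k (i : int) : i < k%:Z - L%:Z -> X i = x_ k i.
  move=> ik; rewrite -[X i]/(x_ (absz (i + L%:Z)).+1 i).
  have [iL|iL] := ltP i (- L%:Z); first by rewrite (low k)//; apply: low.
  have [a aE] : exists a : nat, a%:Z = i + L%:Z by exists (absz (i + L%:Z)); lia.
  rewrite -aE /=; have -> : k = (a.+1 + (k - a.+1))%N by lia.
  by rewrite stab//; lia.
exists X; apply: laurentP => i; rewrite laurentD.
pose k := (absz (i + L%:Z)).+1.
rewrite (XE k.+1); last by lia.
rewrite xS coefB -addrA addrC [- _ + _]addrC -coefB -GB G_causal ?add0r// => j ji.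
by rewrite coefB (XE k) ?subrr//; lia.
Qed.
End CausalPerturbation.

(** * Coefficientwise extension and bases over Laurent series *)

Section LaurentMap.
Variables (k : fieldType) (V W : lmodType k).

(** Only the constant term acts on the leading coefficient; hence the deformed coboundary minus the
    original one raises the order in hbar. *)
Lemma laurent_op_lead (D : nat -> {linear V -> W}) (v : laurent V) n :
  (forall i, i < n -> v i = 0) -> laurent_op D v n = D 0%N (v n).
Proof.
move=> v0; rewrite /= /laurent_op_coef (@fsumE _ _ [:: 0%N]).
  by rewrite /= big_seq1 subr0.
by case=> // i; rewrite v0 ?linear0 ?eqxx//; lia.
Qed.

(** Written as a formal operator with constant term only, so that linearity over [laurent k] is
    inherited. *)
Definition laurent_map (f : {linear V -> W}) : {linear laurent V -> laurent W} :=
  laurent_op (fun i => if i is 0%N then f else \0).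

Lemma laurent_mapE f v n : laurent_map f v n = f (v n).
Proof.
rewrite /= /laurent_op_coef (@fsumE _ _ [:: 0%N]).
  by rewrite /= big_seq1 subr0.
by case=> // i; rewrite eqxx.
Qed.
End LaurentMap.

Section LaurentBasis.
Variables (k : fieldType) (m : nat).

Fact laurent_row_subproof (v : laurent 'rV[k]_m) (j : 'I_m) :
  (fun i => v i 0 j) \in @bounded_below k.
Proof.
have [N vN] := laurent_bound v; apply/asboolP.
by exists (- N%:Z) => i /vN ->; rewrite mxE.
Qed.

Definition laurent_row (v : laurent 'rV[k]_m) : 'rV[laurent k]_m :=
  \row_j Laurent (laurent_row_subproof v j).

Lemma laurent_rowE v j i : laurent_row v 0 j i = v i 0 j.
Proof. by rewrite mxE. Qed.

Lemma laurent_row_linear : linear laurent_row.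
Proof.
move=> a v w; apply/rowP => j; apply: laurentP => n.
rewrite laurent_rowE laurentD !mxE laurentD /=; congr (_ + _).
have [r P] := cauchy_supp (@scale0r k _) (@scaler0 k _) a v n.
rewrite /cauchy (raddf_fsum (h := fun u : 'rV[k]_m => u 0 j) _ _ P) ?mxE//.
  by apply: eq_fsbigr => i _; rewrite mxE.
by move=> x y; rewrite mxE.
Qed.

Lemma laurent_row_inj : injective laurent_row.
Proof.
move=> v w vw; apply: laurentP => n; apply/rowP => j.
by rewrite -!laurent_rowE vw.
Qed.

(** Finitely many coordinates have a common lower bound. *)
Lemma laurent_row_surj u : exists v, laurent_row v = u.
Proof.
have /choice[N uN] j := laurent_bound (u 0 j).
have vP : (fun i => \row_j u 0 j i) \in @bounded_below 'rV[k]_m.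
  apply/asboolP; exists (- (\max_j N j)%N%:Z) => i iN; apply/rowP => j.
  by rewrite !mxE uN//; have := leq_bigmax (F := N) j; lia.
exists (Laurent vP); apply/rowP => j; apply: laurentP => i.
by rewrite laurent_rowE mxE.
Qed.

(** For M the image of [e], this gives a basis of M((hbar)), seen as the series with all
    coefficients in M. *)
Lemma laurent_free_extension (V : lmodType k) (e : {linear 'rV[k]_m -> V}) :
    injective e ->
  exists2 phi : {linear 'rV[laurent k]_m -> laurent V}, injective phi &
    forall x, (exists u, phi u = x) <-> (forall i, exists c, e c = x i).
Proof.
move=> eI; have [r rE] := linear_fun laurent_row_linear.
have rI : injective r by move=> x y; rewrite !rE; apply: laurent_row_inj.
have rS y : exists x, r x = y.
  by have [x <-] := laurent_row_surj y; exists x; rewrite rE.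
have [s rK sK] := linear_inverse rI rS.
exists (laurent_map e \o s) => [u v /= uv|x].
  apply: (can_inj sK); apply: laurentP => n; apply: eI.
  by rewrite -!laurent_mapE; move/(congr1 (fun x : laurent V => x n)): uv.
split=> [[u <-] i|/choice[c cE]].
  by exists (s u i); rewrite /comp laurent_mapE.
(* Since [e] is injective, the chosen preimages vanish wherever [x] does. *)
have cP : c \in @bounded_below 'rV[k]_m.
  have [N xN] := laurent_bound x; apply/asboolP; exists (- N%:Z) => i iN.
  by apply: eI; rewrite cE linear0 xN.
exists (r (Laurent cP)); apply: laurentP => n.
by rewrite /comp laurent_mapE rK cE.
Qed.
End LaurentBasis.

(** * Cohomology computed by a finite dimensional subcomplex *)

Lemma in_imageD (F : fieldType) (C : cochain_complex F) n (x y : C n) :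
  in_image x -> in_image y -> in_image (x + y).
Proof.
case: n x y => [|n] x y /=; first by move=> -> ->; rewrite addr0.
by move=> [u <-] [v <-]; exists (u + v); rewrite linearD.
Qed.

Lemma cobound_in_image (F : fieldType) (C : cochain_complex F) n (x : C n) :
  in_image x -> cobound C n x = 0.
Proof.
case: n x => [|n] x; first by move=> ->; rewrite linear0.
by case=> y <-; rewrite coboundK.
Qed.

Section Reduction.
Variables (F : fieldType) (C : cochain_complex F) (m : nat -> nat).
Variable phi : forall n, {linear 'rV[F]_(m n) -> C n}.
Hypothesis phi_inj : forall n, injective (phi n).
Hypothesis phi_cobound : forall n u, exists v, phi n.+1 v = cobound C n (phi n u).
(** On cocycles this makes the inclusion of the subcomplex surjective on cohomology; on elements
    whose coboundary lies in the subcomplex it yields injectivity. *)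
Hypothesis phi_retract : forall n (y : C n),
  (exists v, phi n.+1 v = cobound C n y) -> exists u, in_image (y - phi n u).

Lemma reduced_matrix n :
  {A : 'M_(m n, m n.+1) | forall u, phi n.+1 (u *m A) = cobound C n (phi n u)}.
Proof.
apply: cid; have [f fE] := choice (@phi_cobound n).
have fL : linear f.
  by move=> a u v; apply: (@phi_inj n.+1); rewrite linearP !fE !linearP.
have [g gE] := linear_fun fL.
by exists (lin1_mx g) => u; rewrite mul_rV_lin1 gE fE.
Qed.

Let A n := projT1 (reduced_matrix n).
Let phiA n u : phi n.+1 (u *m A n) = cobound C n (phi n u).
Proof. by rewrite /A; case: reduced_matrix. Qed.

(** The incoming image as a row space; [<<_>>] makes it square, so that both cases have the same
    type. *)
Let inA n : 'M_(m n) := if n is p.+1 then <<A p>>%MS else 0.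

Let phi_in_image n u : in_image (phi n u) <-> (u <= inA n)%MS.
Proof.
case: n u => [|n] u /=.
  rewrite submx0; split=> [u0|/eqP->]; last by rewrite linear0.
  by apply/eqP/(@phi_inj 0); rewrite u0 linear0.
rewrite genmxE; split=> [[y yu]|/submxP[w ->]]; last by exists (phi n w); rewrite -phiA.
(* A preimage of [phi u] can be moved into the subcomplex without changing its coboundary. *)
have [w /cobound_in_image/eqP] := phi_retract (ex_intro _ u (esym yu)).
rewrite linearB subr_eq0 yu -phiA => /eqP/(@phi_inj n.+1) ->.
exact: submxMl.
Qed.

Let phi_cocycle n u : (phi n u \in @is_cocycle F C n) = (u <= kermx (A n))%MS.
Proof.
rewrite inE -phiA; apply/eqP/sub_kermxP => [u0|->]; last by rewrite linear0.
by apply: (@phi_inj n.+1); rewrite u0 linear0.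
Qed.

Let inA_ker n : (inA n <= kermx (A n))%MS.
Proof.
apply/rV_subP => u uA; rewrite -phi_cocycle.
by apply/eqP/cobound_in_image/phi_in_image.
Qed.

(** A complement of the coboundaries within the cocycles of the subcomplex. *)
Let W n := (kermx (A n) :\: inA n)%MS.

Let W_cocycle n (u : 'rV_(\rank (W n))) :
  phi n (u *m row_base (W n)) \in @is_cocycle F C n.
Proof.
rewrite phi_cocycle (submx_trans (submxMl _ _))// eq_row_base.
exact: diffmxSl.
Qed.

Let psi n u : cohomology C n := cohomology_class (Cocycle (@W_cocycle n u)).

Let psi_linear n : linear (@psi n).
Proof.
move=> a u v; rewrite -[_ *: psi u]/(cohomology_scale _ _) cohomology_scaleE.
rewrite -cohomology_classD; congr cohomology_class; apply: val_inj => /=.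
by rewrite mulmxDl -scalemxAl linearP.
Qed.

(** Injective because [W] meets the coboundaries trivially; surjective because every cocycle is
    cohomologous to some [phi u], and [u] splits into a part in [W] and a coboundary. *)
Let has_dim_psi n : has_dim (cohomology C n) (\rank (W n)).
Proof.
have [g gE] := linear_fun (@psi_linear n).
apply: (@has_dimI _ _ _ g) => [u v|y].
  rewrite !gE => /cohomology_class_eq /=; rewrite -linearB => /phi_in_image.
  rewrite -mulmxBl => uvA; apply/eqP; rewrite -subr_eq0.
  rewrite -(mulmx_free_eq0 _ (row_base_free (W n))) -submx0.
  rewrite -(capmx_diff (kermx (A n)) (inA n)) sub_capmx uvA andbT.
  by rewrite (submx_trans (submxMl _ _))// eq_row_base.
have [z ->] := cohomology_classP y; have /eqP z0 := valP z.
have [|u zu] := @phi_retract n (val z).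
  by exists 0; rewrite z0 linear0.
have : (u <= kermx (A n))%MS.
  rewrite -phi_cocycle inE; have /eqP := cobound_in_image zu.
  by rewrite linearB z0 sub0r oppr_eq0.
rewrite -(addsmx_diff_cap_eq (kermx (A n)) (inA n)) => /sub_addsmxP[[a b] uE].
have /submxP[w wE] : (a *m W n <= row_base (W n))%MS by rewrite eq_row_base submxMl.
exists w; rewrite gE; apply/esym/cohomology_class_eq => /=; rewrite -wE.
have -> : a *m W n = u - b *m (kermx (A n) :&: inA n)%MS by rewrite uE addrK.
rewrite linearB opprB addrCA addrC; apply: in_imageD => //; apply/phi_in_image.
by rewrite (submx_trans (submxMl _ _))// capmxSr.
Qed.

(** Rank-nullity, with [r n] the rank of the coboundary of the subcomplex leaving degree [n]. *)
Lemma reduction_dims : exists r : nat -> nat, forall n,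
  let rp := if n is p.+1 then r p else 0%N in
  (r n + rp <= m n)%N /\ has_dim (cohomology C n) (m n - (r n + rp)).
Proof.
exists (fun n => \rank (A n)) => n rp.
have rpE : rp = \rank (inA n).
  by rewrite /rp /inA; case: n {rp} => [|n]; rewrite ?mxrank0 ?mxrank_gen.
have := mxrank_cap_compl (kermx (A n)) (inA n); rewrite -/(W n) mxrank_ker.
have -> : \rank (kermx (A n) :&: inA n)%MS = rp.
  by rewrite rpE; apply/eqmx_rank/eqmxP/capmx_idPr.
have := rank_leq_row (A n) => ? ?.
suff -> : (m n - (\rank (A n) + rp) = \rank (W n))%N by split=> //; lia.
by lia.
Qed.
End Reduction.

(** * Alternating sums of dimensions *)

Section EulerCharacteristic.
Variables (F : fieldType) (C : cochain_complex F).

Lemma euler_char_sum (h : nat -> nat) N :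
    (forall n, has_dim (cohomology C n) (h n)) ->
    (forall n, (N <= n)%N -> h n = 0%N) ->
  euler_char C = \sum_(n < N) (-1) ^+ n * (h n)%:Z.
Proof.
move=> hC h0; rewrite /euler_char (@fsum_ord _ N).
  by apply: eq_bigr => n _; rewrite (vdimP (hC n)).
move=> n; rewrite (vdimP (hC n)); apply: contraNltn => /h0->.
by rewrite mulr0.
Qed.
End EulerCharacteristic.

(** Each rank occurs in two consecutive degrees with opposite signs, except the last one. *)
Lemma alternating_telescope (r : nat -> nat) N :
  \sum_(n < N) (-1) ^+ n * (r n + (if nat_of_ord n is p.+1 then r p else 0))%N%:Z =
  if N is p.+1 then (-1) ^+ p * (r p)%:Z else 0 :> int.
Proof.
elim: N => [|[|N] IH]; first by rewrite big_ord0.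
  by rewrite big_ord_recr big_ord0 /= add0r addn0.
by rewrite big_ord_recr IH /= PoszD mulrDr addrCA -mulrDl exprS mulN1r subrr mul0r addr0.
Qed.

(** * Contractions and harmonic representatives *)

(* In degree 0 the target of [s] is the zero space. *)
Definition contraction_ker (F : fieldType) (C : nat -> lmodType F)
    (s : forall n, {linear C n.+1 -> C n}) n : C n -> Prop :=
  match n with 0 => fun=> True | p.+1 => fun x => s p x = 0 end.

(** From a generalized inverse g of delta, t = g delta g also satisfies t delta t = t; then s = t (1
    - t delta) has square zero, because 1 - t delta kills the image of t. *)
Lemma exists_contraction (F : fieldType) (C : cochain_complex F) :
  exists s : forall n, {linear C n.+1 -> C n},
    [/\ forall n x, s n (s n.+1 x) = 0,
        forall n x, s n (cobound C n (s n x)) = s n x &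
        forall n x, cobound C n (s n (cobound C n x)) = cobound C n x].
Proof.
pose g n := projT1 (cid (generalized_inverse (cobound C n))).
have gP n x : cobound C n (g n (cobound C n x)) = cobound C n x.
  by rewrite /g; case: cid.
pose t n x := g n (cobound C n (g n x)).
have tL n : linear (t n) by move=> a x y; rewrite /t !linearP.
have tP n x : t n (cobound C n (t n x)) = t n x by rewrite /t !gP.
have dtd n x : cobound C n (t n (cobound C n x)) = cobound C n x by rewrite /t !gP.
have t0 n : t n 0 = 0 by rewrite /t !linear0.
have tB n x y : t n (x - y) = t n x - t n y by rewrite /t !linearB.
pose s n x := t n (x - t n.+1 (cobound C n.+1 x)).
have sL n : linear (s n).
  by move=> a x y; rewrite /s linearP !tL opprD addrACA -scalerBr tL.
have h n := cid (linear_fun (@sL n)).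
exists (fun n => projT1 (h n)).
have hE n x : projT1 (h n) x = s n x by case: (h n) => f /= ->.
split=> n x; rewrite !hE /s.
- by rewrite tP subrr t0.
- by rewrite coboundK t0 subr0 tP.
- by rewrite coboundK t0 subr0 dtd.
Qed.

Section Contraction.
Variables (F : fieldType) (C : cochain_complex F).
Variable s : forall n, {linear C n.+1 -> C n}.
Hypothesis sds : forall n x, s n (cobound C n (s n x)) = s n x.
Hypothesis dsd : forall n x, cobound C n (s n (cobound C n x)) = cobound C n x.

(** The projection onto the coboundaries along the kernel of [s]. *)
Let ds n : C n -> C n :=
  match n with 0 => fun=> 0 | p.+1 => fun x => cobound C p (s p x) end.

Let ds_linear n : linear (@ds n).
Proof.
by case: n => [|n] a x y /=; rewrite ?linearP ?scaler0 ?addr0.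
Qed.

Let ds_image n x : in_image (@ds n x).
Proof. by case: n x => [|n] x //=; exists (s n x). Qed.

Let ds_id n x : in_image x -> @ds n x = x.
Proof. by case: n x => [|n] x /=; [move=> -> | move=> [y <-]; rewrite dsd]. Qed.

Let ds_ker n x : contraction_ker s x -> @ds n x = 0.
Proof. by case: n x => [|n] x //= ->; rewrite linear0. Qed.

Let ker_subds n x : contraction_ker s (x - @ds n x).
Proof. by case: n x => [|n] x //=; rewrite linearB sds subrr. Qed.

Lemma harmonic_basis n m : has_dim (cohomology C n) m ->
  exists2 e : {linear 'rV[F]_m -> C n}, injective e &
    forall x, (exists c, e c = x) <->
      contraction_ker s x /\ s n (cobound C n x) = 0.
Proof.
move=> /has_dimE[g gI gS].
have [p pE] := linear_fun (@ds_linear n).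
pose pi (z : C n) := z - p z.
have pi0 z : in_image z -> pi z = 0 by move=> zi; rewrite /pi pE ds_id// subrr.
have piD a x y : pi (a *: x + y) = a *: pi x + pi y.
  by rewrite /pi linearP opprD addrACA scalerBr.
have pi_eq (x y : cocycle C n) : cohomology_class x = cohomology_class y ->
    pi (val x) = pi (val y).
  move=> /cohomology_class_eq/pi0 /=; rewrite addrC -scaleN1r piD scaleN1r => /eqP.
  by rewrite addrC subr_eq0 => /eqP.
(* The representatives [z u] need not be linear in [u]; since [pi] depends only on the class, the
   composite is. *)
have /choice[z zE] := fun u => cohomology_classP (g u).
have eL : linear (fun u => pi (val (z u))).
  move=> a u v /=; rewrite -piD; apply: (pi_eq _ (a *: z u + z v)).
  rewrite -zE linearP cohomology_classD -cohomology_scaleE !zE.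
  by rewrite -!zE.
have [e eE] := linear_fun eL.
exists e => [u v|x].
  rewrite !eE => uv; apply: gI; rewrite !zE; apply/cohomology_class_eq => /=.
  have -> : val (z u) - val (z v) = ds (val (z u) - val (z v)); last exact: ds_image.
  apply/eqP; rewrite -subr_eq0 -pE -/(pi _) addrC -scaleN1r piD uv.
  by rewrite scaleN1r addNr.
split=> [[c <-]|[xk xd]].
  rewrite eE /pi pE; split; first exact: ker_subds.
  have /eqP zd := valP (z c); rewrite linearB zd (cobound_in_image (ds_image _)).
  by rewrite subrr linear0.
(* Here delta x = delta s delta x = 0. *)
have xc : x \in @is_cocycle F C n by apply/eqP; rewrite -dsd xd linear0.
have [c cE] := gS (cohomology_class (Cocycle xc)).
exists c; rewrite eE (pi_eq _ (Cocycle xc)) -?zE//=.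
by rewrite /pi pE ds_ker// subr0.
Qed.
End Contraction.

(** * Transport of the harmonic space to the deformed complex *)

Section DeformedContraction.
Variables (k : fieldType) (V : cochain_complex k) (Vh : deformation V).
Variable s : forall n, {linear V n.+1 -> V n}.
Hypothesis ss : forall n x, s n (s n.+1 x) = 0.
Hypothesis sds : forall n x, s n (cobound V n (s n x)) = s n x.

Local Notation Vhbar := (deformed_complex Vh).
Local Notation d n := (cobound Vhbar n).

Let S n : {linear laurent (V n.+1) -> laurent (V n)} := laurent_map (s n).
Let d0 n : {linear laurent (V n) -> laurent (V n.+1)} := laurent_map (cobound V n).
Let G n (x : laurent (V n)) : laurent (V n) := S n (d n x - d0 n x).

Let G_linear n : linear (@G n).
Proof.
move=> a x y; rewrite /G (linearP (d n)) (linearP (d0 n)) opprD addrACA -scalerBr.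
by rewrite linearP.
Qed.

Let GB n : {morph @G n : x y / x - y}.
Proof. by have [g gE] := linear_fun (@G_linear n); move=> x y; rewrite -!gE linearB. Qed.

Let G_causal n (x : laurent (V n)) (i : int) :
  (forall j, j < i -> x j = 0) -> G x i = 0.
Proof.
move=> x0; have e : lcoef (d n x - d0 n x) i = 0.
  rewrite -[LHS]/(laurent_op (deform Vh n) x i - d0 n x i).
  by rewrite laurent_op_lead// deform0 laurent_mapE subrr.
by rewrite /G /S laurent_mapE e linear0.
Qed.

Let T n (x : laurent (V n)) := x + G x.

Let SS n x : S n (S n.+1 x) = 0.
Proof. by apply: laurentP => i; rewrite /S !laurent_mapE ss. Qed.

Let Sd0S n x : S n (d0 n (S n x)) = S n x.
Proof. by apply: laurentP => i; rewrite /S /d0 !laurent_mapE sds. Qed.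

Local Notation S_ker := (@contraction_ker (laurent k) (cochain Vhbar) S _).

Let contraction_kerP n (x : laurent (V n)) :
  S_ker x <-> forall i, contraction_ker s (x i).
Proof.
case: n x => [|n] x //=; split=> [Sx i|sx].
  by rewrite -laurent_mapE; apply: (congr1 (fun y : laurent _ => y i) Sx).
by apply: laurentP => i; rewrite [LHS]laurent_mapE sx.
Qed.

Let contraction_ker_T n (x : laurent (V n)) :
  S_ker (T x) <-> S_ker x.
Proof. by case: n x => [|n] x //=; rewrite linearD SS addr0. Qed.

(** Since S d0 S = S, one has S d0 G = S (d - d0), which turns S d0 into S d. *)
Let Sd0T n (x : laurent (V n)) : S n (d0 n (T x)) = S n (d n x).
Proof. by rewrite /T (linearD (d0 n)) (linearD (S n)) /G Sd0S -(linearD (S n)) addrC subrK. Qed.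

Let kill n (y : laurent (V n.+1)) : exists q, S n (y - d n q) = 0.
Proof.
have [q qE] := add_causal_surj (@GB n) (@G_causal n) (S n y).
exists q; apply/eqP; rewrite linearB subr_eq0 -qE; apply/eqP.
(* Thus [q] lies in the image of S, so S d0 q = q and S d q = q + G q = S y. *)
have qS : q = S n (y - (d n q - d0 n q)) by rewrite linearB -qE addrK.
by rewrite /G linearB {1}qS -{1}(Sd0S (y - _)) -qS addrC subrK.
Qed.

(** The conditions on x say that T x lies in M((hbar)), because S T = S and S d0 T = S d; so the
    inverse of T carries a basis of M((hbar)) over. *)
Lemma deformed_basis n m (e : {linear 'rV[k]_m -> V n}) : injective e ->
    (forall x, (exists c, e c = x) <->
      contraction_ker s x /\ s n (cobound V n x) = 0) ->
  exists2 phi : {linear 'rV[laurent k]_m -> Vhbar n}, injective phi &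
    forall x, (exists u, phi u = x) <-> S_ker x /\ S n (d n x) = 0.
Proof.
move=> eI eP; have [phi phiI phiP] := laurent_free_extension eI.
have TL : linear (@T n).
  by move=> a x y; rewrite /T G_linear addrACA -scalerDr.
have [t tE] := linear_fun TL.
have tI : injective t.
  by move=> x y; rewrite !tE; apply: (add_causal_inj (@GB n) (@G_causal n)).
have tS y : exists x, t x = y.
  have [x <-] := add_causal_surj (@GB n) (@G_causal n) y.
  by exists x; rewrite tE.
have [t' tK t'K] := linear_inverse tI tS.
exists (t' \o phi) => [u v /= /(can_inj t'K)/phiI//|x].
have -> : (exists u, (t' \o phi) u = x) <-> exists u, phi u = t x.
  split=> -[u]; last by move=> ux; exists u; rewrite /= ux tK.
  by move=> <-; exists u; rewrite /= t'K.
rewrite phiP -Sd0T -contraction_ker_T contraction_kerP tE.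
split=> [xP|[xk xd] i].
  split=> [i|]; first by have /eP[] := xP i.
  by apply: laurentP => i; rewrite /S /d0 !laurent_mapE; have /eP[] := xP i.
by apply/eP; split=> //; rewrite -!laurent_mapE -/(S n) -/(d0 n) xd.
Qed.

Lemma deformed_reduction m (e : forall n, {linear 'rV[k]_(m n) -> V n}) :
    (forall n, injective (e n)) ->
    (forall n x, (exists c, e n c = x) <->
      contraction_ker s x /\ s n (cobound V n x) = 0) ->
  exists r : nat -> nat, forall n,
    let rp := if n is p.+1 then r p else 0%N in
    (r n + rp <= m n)%N /\ has_dim (cohomology Vhbar n) (m n - (r n + rp)).
Proof.
move=> eI eP.
have h n := cid2 (deformed_basis (eI n) (eP n)).
pose phi n := s2val (h n).
have phiI n : injective (phi n) := s2valP (h n).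
have phiP n x : (exists u, phi n u = x) <-> S_ker x /\ S n (d n x) = 0.
  exact: (s2valP' (h n)).
apply: (reduction_dims phiI) => [n u|n y /phiP[Sdy _]].
  apply/phiP; split; last by rewrite coboundK linear0.
  by have /phiP[] : exists v, phi n v = phi n u by exists u.
(* Subtracting a coboundary [q] moves [y] into the subcomplex: d (y - q) = d y is still killed by S.
   In degree 0 only [q = 0] is available, and the kernel condition is void. *)
have [q [qi [qk qd]]] : exists q : Vhbar n,
    in_image q /\ S_ker (y - q) /\ d n q = 0.
  case: n y Sdy => [|n] y Sdy; first by exists 0; split=> //; split=> //; rewrite linear0.
  have [q qk] := kill y; exists (d n q); split; first by exists q.
  by rewrite coboundK.
have [|u uE] := (phiP n (y - q)).2; first by rewrite linearB qd subr0.
by exists u; rewrite uE opprB addrC subrK.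
Qed.
End DeformedContraction.

(** * Comparison of dimensions and Euler characteristics *)

Theorem theorem3 (k : fieldType) (V : cochain_complex k)
    (Hfin : forall n, finite_dim (cohomology V n))
    (Hvan : exists N : nat, forall n, (N <= n)%N -> forall u : cohomology V n, u = 0)
    (Vh : deformation V) :
  let Vhbar := deformed_complex Vh in
  [/\ forall n, finite_dim (cohomology Vhbar n),
      exists N : nat, forall n, (N <= n)%N -> forall u : cohomology Vhbar n, u = 0,
      euler_char Vhbar = euler_char V &
      forall n, (vdim (cohomology Vhbar n) <= vdim (cohomology V n))%N].
Proof.
move=> Vhbar; have [m mV] := choice Hfin.
have [s [ss sds dsd]] := exists_contraction V.
have h n := cid2 (harmonic_basis sds dsd (mV n)).
have [r rP] := deformed_reduction Vh ss sds
  (fun n => s2valP (h n)) (fun n => s2valP' (h n)).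
(* The drop in dimension in degree [n]: outgoing plus incoming rank. *)
pose r' n := (r n + (if n is p.+1 then r p else 0))%N.
have r'm n : (r' n <= m n)%N := (rP n).1.
have mVh n : has_dim (cohomology Vhbar n) (m n - r' n) := (rP n).2.
have [N HN] := Hvan.
have m0 n : (N <= n)%N -> m n = 0%N by move=> /HN; apply: (has_dim0 (mV n)).1.
split=> [n| | |n].
- by exists (m n - r' n)%N.
- by exists N => n /m0 mn0; apply/(has_dim0 (mVh n)); rewrite mn0.
- rewrite (euler_char_sum (N := N) mVh); last by move=> n /m0->.
  rewrite (euler_char_sum (N := N) mV) //.
  apply/eqP; rewrite -subr_eq0 -sumrB -oppr_eq0 -sumrN.
  have -> : \sum_(i < N) - ((-1) ^+ i * (m i - r' i)%N%:Z - (-1) ^+ i * (m i)%:Z)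
      = \sum_(i < N) (-1) ^+ i * (r' i)%:Z.
    apply: eq_bigr => i _; rewrite -mulrBr -mulrN; congr (_ * _).
    by have := r'm i; lia.
  (* The one surviving rank is part of the drop in the next degree, where [m] is 0. *)
  rewrite alternating_telescope; case: N m0 {HN} => // N m0.
  by have := r'm N.+1; rewrite m0// /r' leqn0 addn_eq0 => /andP[_ /eqP->]; rewrite mulr0.
- by rewrite (vdimP (mV n)) (vdimP (mVh n)) leq_subr.
Qed.
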